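(* Let $m,n,r$ be positive integers with $\gcd(m,n)=\gcd(m,r-1)=1$ and $r^n\equiv 1\pmod m$, let $$\mathrm{ZM}(m,n,r)=\langle a,b\mid a^m=b^n=1,\ b^{-1}ab=a^r\rangle,$$ and let $d$ be the multiplicative order of $r$ modulo $m$. Then $$\psi(C_m)+m(\psi(C_n)-1)\leq\psi(\mathrm{ZM}(m,n,r))<\psi(C_m)+m^2(\psi(C_n)-1).$$ Moreover, the first inequality becomes an equality if and only if $d=n$ and for all proper divisors $m_1$ of $m$ and $n_1$ of $n$, we have $m_1\nmid r^{n_1}-1$.
   Context: For a finite group $K$, $\psi(K)=\sum_{x\in K}o(x)$, where $o(x)$ denotes the order of the element $x$ in $K$. $C_k$ denotes the cyclic group of order $k$. The groups $\mathrm{ZM}(m,n,r)$ are the finite groups all of whose Sylow subgroups are cyclic; $\mathrm{ZM}(m,n,r)$ has order $mn$ and is a semidirect product of $\langle a\rangle\cong C_m$ by $\langle b\rangle\cong C_n$. A proper divisor of a positive integer $k$ means here a divisor of $k$ different from $1$ and from $k$.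
   Formalization: The strict upper bound and the equality criterion are stated only for m > 1: for m = 1 the group is C_n and d = 1, so the strict bound reads ψ(C_n) < ψ(C_n), and for n > 1 equality holds although d ≠ n. The lower bound is kept for all m ≥ 1. *)

(* Defs.v *)
From mathcomp Require Export all_boot all_algebra all_fingroup all_solvable.

Set Implicit Arguments.
Unset Strict Implicit.
Unset Printing Implicit Defensive.

Definition psi (gT : finGroupType) (K : {set gT}) : nat := \sum_(x in K) #[x]%g.

(* [Zp k] is the additive cyclic group of order k for every k >= 1; it is the
   trivial subgroup for k = 1, unlike the full type 'Z_1, which has order 2. *)
Definition psi_cyclic (k : nat) : nat := psi (Zp k).

Definition is_mult_order (m r d : nat) : Prop :=
  [/\ 0 < d, r ^ d = 1 %[mod m]
    & forall k : nat, 0 < k -> r ^ k = 1 %[mod m] -> d <= k].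

(* Here 1 is not counted as a proper divisor. *)
Definition proper_divisor (k j : nat) : bool := [&& j %| k, j != 1 & j != k].

(* G is a copy of <a, b | a^m = b^n = 1, b^-1 a b = a^r>; in the library
   a ^ b is b^-1 * a * b. Such a presentation with m, n > 0 and r^n = 1 mod m
   defines a finite group, hence it determines G up to isomorphism. *)
Definition is_ZM (m n r : nat) (gT : finGroupType) (G : {group gT}) : Prop :=
  (G \isog Grp (a : b : a ^+ m = b ^+ n = 1, a ^ b = a ^+ r))%g.

(* Main.v *)
Require Import Defs.
From mathcomp Require Import frobenius extremal.

(** The group is the semidirect product of K = <a>, of order m, by H = <b>, of
    order n. For h in H and k in K, the order of k * h is a multiple of that of
    h and divides m times it ([order_sdprod_dvd], [order_sdprod_dvd_mul]).
    Summing over the coset of K through each h <> 1, and adding the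
    contribution psi(C_m) of K itself, gives both inequalities. The upper one
    is strict when m > 1: then n > 1 too, and h itself has an order smaller
    than m times its own.

    The lower bound is attained exactly when every k * h with h <> 1 has the
    order of h. As m and n are coprime, this says that H acts on K without
    nontrivial fixed points, that is, semiregularly ([psi_sdprod_leqif]). For
    the action of b by the power r, an element of order m1 is fixed by b ^+ n1
    exactly when m1 divides r ^ n1 - 1, so semiregularity becomes the stated
    arithmetic condition ([semiregular_cycleP]).

    The presentation must still be shown to define a group of order m * n and
    not a smaller one; a model of that order is built from the power
    automorphism of a cyclic group ([dvdn_card_ZM], [ZM_sdprod]). *)

Section GroupTheory.

Local Set Implicit Arguments.
Local Unset Strict Implicit.
Local Open Scope group_scope.

(** * Sums of element orders *)

Lemma psi_split1 (gT : finGroupType) (A : {group gT}) : psi A = (1 + \sum_(x in A^#) #[x])%N.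
Proof. by rewrite /psi (big_setD1 1) //= order1. Qed.

Lemma psi_isog (aT rT : finGroupType) (A : {group aT}) (B : {group rT}) :
  A \isog B -> psi A = psi B.
Proof.
case/isogP=> f injf <-; rewrite /psi morphimEdom big_imset /=; last exact/injmP.
by apply: eq_bigr => x Ax; rewrite order_injm.
Qed.

Lemma psi_cycle (gT : finGroupType) (x : gT) : psi <[x]> = psi_cyclic #[x].
Proof.
apply: (@psi_isog _ _ <[x]>%G (Zp_group #[x])).
by rewrite isog_sym Zp_isog.
Qed.

(** * Semidirect products *)

Section SemidirectProduct.

Variables (gT : finGroupType) (G K H : {group gT}).
Hypothesis defG : K ><| H = G.

Lemma reindex_sdprod (F : gT -> nat) :
  (\sum_(x in G) F x = \sum_(h in H) \sum_(k in K) F (k * h)%g)%N.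
Proof.
have [_ <- _ tiKH] := sdprodP defG.
rewrite exchange_big pair_big_dep /=.
have -> : K * H = [set p.1 * p.2 | p in setX K H].
  apply/setP=> x; apply/mulsgP/imsetP => [[k h Kk Hh ->]|[[k h]]].
    by exists (k, h); rewrite ?inE ?Kk.
  by rewrite inE /= => /andP[Kk Hh] ->; exists k h.
rewrite big_imset /=; first by apply: eq_bigl => -[k h]; rewrite inE.
move=> [k h] [k' h'] /setXP[/= Kk Hh] /setXP[/= Kk' Hh'] eq_kh.
move: (congr1 (divgr K H) eq_kh) (congr1 (remgr K H) eq_kh).
by rewrite !divgrMid ?remgrMid // => -> ->.
Qed.

Lemma psi_sdprod :
  psi G = (psi K + \sum_(h in H^#) \sum_(k in K) #[(k * h)%g])%N.
Proof.
rewrite {1}/psi reindex_sdprod (big_setD1 1) //=; congr (_ + _)%N.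
by apply: eq_bigr => k _; rewrite mulg1.
Qed.

(** The powers of k * h modulo K give both bounds on its order: a trivial power
    forces h ^+ j into K, and the power of exponent #[h] lies in K. *)
Lemma sdprod_expg_mod j h k :
  h \in H -> k \in K -> (k * h) ^+ j \in K :* (h ^+ j).
Proof.
move=> Hh Kk; have [_ _ nKH _] := sdprodP defG.
have nKh := subsetP nKH h Hh; have nKk := subsetP (normG K) k Kk.
apply/rcoset_kercosetP; rewrite ?groupX ?groupM //.
by rewrite !morphX ?groupM //= coset_kerl.
Qed.

Lemma order_sdprod_dvd h k : h \in H -> k \in K -> #[h] %| #[k * h].
Proof.
move=> Hh Kk; have [_ _ _ tiKH] := sdprodP defG.
have := sdprod_expg_mod #[k * h] Hh Kk; rewrite expg_order mem_rcoset mul1g groupV.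
by move=> Khj; rewrite order_dvdn -in_set1 -[[set 1]]tiKH inE Khj groupX.
Qed.

Lemma order_sdprod_dvd_mul h k :
  h \in H -> k \in K -> #[k * h] %| #|K| * #[h].
Proof.
move=> Hh Kk; have := sdprod_expg_mod #[h] Hh Kk; rewrite expg_order rcoset1.
by move=> Kx; rewrite order_dvdn mulnC expgM -order_dvdn order_dvdG.
Qed.

(** The order of k * h is bounded by #|K| * #[h], and this bound is not attained
    by k = 1, since 1 * h has order #[h] and K is nontrivial. *)
Lemma psi_sdprod_lt :
  K :!=: 1 -> H :!=: 1 -> psi G < psi K + #|K| ^ 2 * (psi H - 1).
Proof.
move=> ntK ntH; rewrite psi_sdprod (psi_split1 H) addKn ltn_add2l big_distrr /=.
have [h Hh nth] := trivgPn _ ntH; have H1h : h \in H^# by rewrite !inE nth.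
have term_le x : x \in H^# ->
  \sum_(k in K) #[(k * x)%g] <= \sum_(k in K) #|K| * #[x].
  case/setD1P=> _ Hx; apply: leq_sum => k Kk.
  by rewrite dvdn_leq ?muln_gt0 ?cardG_gt0 ?order_gt0 // order_sdprod_dvd_mul.
have termE (x : gT) : (#|K| ^ 2 * #[x])%N = \sum_(k in K) #|K| * #[x].
  by rewrite sum_nat_const mulnA.
rewrite (eq_bigr _ (fun x _ => termE x)) (big_setD1 h) //= [ltnRHS](big_setD1 h) //=.
rewrite -addSn leq_add //; last first.
  by apply: leq_sum => x /setD1P[_ H1x]; apply: term_le.
rewrite (big_setD1 1) //= [leqRHS](big_setD1 1) //= -addSn leq_add //.
  by rewrite mul1g ltn_Pmull ?order_gt0 ?cardG_gt1.
apply: leq_sum => k /setD1P[_ Kk].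
by rewrite dvdn_leq ?muln_gt0 ?cardG_gt0 ?order_gt0 // order_sdprod_dvd_mul.
Qed.

(** Conjugation by K keeps h in its coset K :* h, and the orbit has as many
    elements as K when no k <> 1 commutes with h, so it is the whole coset. *)
Lemma rcoset_class_semiregular h :
  h \in H -> 'C_K[h] = 1 -> K :* h = h ^: K.
Proof.
move=> Hh regh; have [_ _ nKH _] := sdprodP defG.
apply/eqP; rewrite eq_sym eqEcard card_rcoset -index_cent1 regh indexg1 leqnn andbT.
apply/subsetP=> _ /imsetP[k Kk ->].
rewrite mem_rcoset conjgE -!mulgA groupMl ?groupV //.
by rewrite -[h in h * _]invgK -[_^-1^-1 * _]conjgE memJ_norm ?groupV // (subsetP nKH).
Qed.

(** Equality asks that every k * h with h <> 1 have the order of h. If h acts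
    without fixed points, this holds because k * h is conjugate to h; if h
    centralises some c <> 1 in K, it fails because #[c * h] = #[c] * #[h] by
    coprimality. *)
Lemma psi_sdprod_leqif :
    coprime #|K| #|H| ->
  psi K + #|K| * (psi H - 1) <= psi G ?= iff [forall h in H^#, 'C_K[h] == 1].
Proof.
move=> coKH; rewrite psi_sdprod (psi_split1 H) addKn big_distrr /=.
suff leK h : h \in H^# ->
  #|K| * #[h] <= \sum_(k in K) #[(k * h)%g] ?= iff ('C_K[h] == 1).
  have [le_sum eq_sum] := leqif_sum leK.
  by split; rewrite ?leq_add2l // eqn_add2l.
case/setD1P=> nth Hh; rewrite -sum_nat_const.
have le_kh k : k \in K -> #[h] <= #[k * h] ?= iff (#[h] == #[k * h]).
  by move=> Kk; apply/leqif_eq/dvdn_leq; rewrite ?order_gt0 ?order_sdprod_dvd.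
have [le_sum eq_sum] := leqif_sum le_kh; split=> //; rewrite {}eq_sum.
apply/forall_inP/eqP => [eq_ord | regh k Kk]; last first.
  have: k * h \in h ^: K by rewrite -rcoset_class_semiregular // mem_rcoset mulgK.
  by case/imsetP=> x _ ->; rewrite orderJ.
apply/trivgP/subsetP=> c /setIP[Kc /cent1P ch]; rewrite inE -order_eq1.
have := eq_ord c Kc; rewrite orderM.
- by rewrite eq_sym -{2}[#[h]]mul1n eqn_pmul2r ?order_gt0.
- exact/commute_sym.
- exact: coprime_dvdl (order_dvdG Kc) (coprime_dvdr (order_dvdG Hh) coKH).
Qed.

End SemidirectProduct.

(** * The groups ZM(m, n, r) *)

(** The power map by r has n-th iterate the power map by r ^ n, the identity;
    this is the automorphism by which b acts on <a> in ZM(m, n, r). *)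
Lemma Aut_cycle_expg (gT : finGroupType) (a : gT) r n :
    0 < n -> r ^ n = 1 %[mod #[a]] ->
  exists s, [/\ s \in Aut <[a]>, #[s] %| n & s a = a ^+ r].
Proof.
move=> n_gt0 rn1.
have expr x : x \in <[a]> -> x ^+ (r ^ n) = x.
  move=> ax; apply/eqP; rewrite -[eqbRHS]expg1 eq_expg_mod_order.
  by apply/eqP; rewrite -(modn_dvdm _ (order_dvdG ax)) rn1 modn_dvdm ?order_dvdG.
have inj_r : 'injm (cyclem r a).
  apply/subsetP=> x /setIdP[ax]; rewrite !inE /= /cyclem => /eqP xr1.
  by rewrite -(expr x ax) -(prednK n_gt0) expnS expgM xr1 expg1n.
have im_r : cyclem r a @* <[a]> = <[a]>.
  by apply/morphim_fixP=> //; rewrite morphim_cycle ?cycle_id ?cycleX.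
exists (aut inj_r im_r); split; rewrite ?Aut_aut ?autE ?cycle_id //.
set s := aut inj_r im_r; have As : s \in Aut <[a]> by apply: Aut_aut.
rewrite order_dvdn; apply/eqP; apply: (eq_Aut (groupX n As) (group1 _)) => x ax.
have iter_r i y : y \in <[a]> -> (s ^+ i) y = y ^+ (r ^ i).
  elim: i y => [|i IHi] y ay; first by rewrite perm1 expg1.
  by rewrite expgS permM [s y]autE // IHi ?groupX // /cyclem -expgM expnS.
by rewrite perm1 iter_r ?expr.
Qed.

(** If n = 1, then m divides r - 1 as well as being coprime to it. *)
Lemma ZM_index_gt1 m n r :
    1 < m -> 0 < n -> coprime m (r - 1) -> r ^ n = 1 %[mod m] -> 1 < n.
Proof.
move=> m_gt1 n_gt0 co_mr1 rn1; rewrite ltn_neqAle n_gt0 andbT eq_sym.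
apply: contraTneq co_mr1 => n1; rewrite n1 expn1 in rn1.
rewrite /coprime (gcdn_idPl _) ?gtn_eqF //.
by case: r rn1 => [|r] rn1; rewrite ?dvdn0 // -eqn_mod_dvd ?rn1.
Qed.

(** A presentation alone bounds the order only from above, so a concrete model
    of the presentation is needed: the group G maps onto every model. For m > 1
    the model is the semidirect product of C_m by C_n given by the power
    automorphism; for m = 1 it is C_n. *)
Lemma dvdn_card_ZM m n r (gT : finGroupType) (G : {group gT}) :
    0 < m -> 0 < n -> coprime m (r - 1) -> r ^ n = 1 %[mod m] -> is_ZM m n r G ->
  m * n %| #|G|.
Proof.
move=> m_gt0 n_gt0 co_mr1 rn1 ZM_G.
have [m1 | m_gt1] := leqP m 1.
  have {m1 m_gt0 co_mr1 rn1} m1 : m = 1%N by apply/eqP; rewrite eqn_leq m1.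
  rewrite {}m1 mul1n in ZM_G *; rewrite -(card_Zp n_gt0).
  have [x defZ] : exists x, Zp n = <[x]>.
    rewrite /Zp; case: ifP => _; first by exists Zp1; rewrite Zp_cycle.
    by exists 1; rewrite cycle1.
  apply: card_homg; rewrite ZM_G.
  apply/existsP; exists (1, x); rewrite /= !xpair_eqE conj1g !expg1n eqxx !andbT.
  by rewrite cycle1 joing1G defZ eqxx -order_dvdn /order -defZ card_Zp ?dvdnn.
have n_gt1 := ZM_index_gt1 m_gt1 n_gt0 co_mr1 rn1.
have o_a : #[(Zp1 : 'Z_m)] = m by rewrite order_Zp1 Zp_cast.
have rn1' : r ^ n = 1 %[mod #[(Zp1 : 'Z_m)]] by rewrite o_a.
have isoM := Extremal.Grp n_gt1 m_gt1 (Aut_cycle_expg n_gt0 rn1').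
rewrite mulnC -(Extremal.card r n_gt1 m_gt1).
apply: card_homg; rewrite ZM_G; exact: isoGrp_hom isoM.
Qed.

(** The relations force #[a] %| m and #[b] %| n, so that <a> and <b> meet
    trivially; the order of G then leaves no room for proper divisors. *)
Lemma ZM_sdprod m n r (gT : finGroupType) (G : {group gT}) :
    0 < m -> 0 < n -> coprime m n -> coprime m (r - 1) -> r ^ n = 1 %[mod m] ->
    is_ZM m n r G ->
  exists a b : gT,
    [/\ <[a]> ><| <[b]> = G, #[a] = m, #[b] = n & a ^ b = a ^+ r].
Proof.
move=> m_gt0 n_gt0 co_mn co_mr1 rn1 ZM_G.
have dvd_mn := dvdn_card_ZM m_gt0 n_gt0 co_mr1 rn1 ZM_G.
have /existsP[[a b] /= /eqP[defG am bn ab]] := isoGrp_hom ZM_G.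
have dvd_a : #[a] %| m by rewrite order_dvdn am.
have dvd_b : #[b] %| n by rewrite order_dvdn bn.
have nab : <[b]> \subset 'N(<[a]>) by rewrite norms_cycle ab mem_cycle.
have tiab : <[a]> :&: <[b]> = 1.
  by apply: coprime_TIg; apply: coprime_dvdl dvd_a (coprime_dvdr dvd_b co_mn).
have sdG : <[a]> ><| <[b]> = G by rewrite sdprodE // -norm_joinEr.
have oG : #|G| = (#[a] * #[b])%N by rewrite -(sdprod_card sdG).
have dvd_mn' : m * n %| #[a] * #[b] by rewrite -oG.
have oa : #[a] = m.
  apply/eqP; rewrite eqn_dvd dvd_a -(@Gauss_dvdl m _ #[b]).
    exact: dvdn_trans (dvdn_mulr _ _) dvd_mn'.
  exact: coprime_dvdr dvd_b co_mn.
have ob : #[b] = n.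
  by apply/eqP; rewrite eqn_dvd dvd_b -(@dvdn_pmul2l m) //= -{2}oa.
by exists a, b.
Qed.

(** * Semiregularity as a divisibility condition *)

Section Metacyclic.

Variables (gT : finGroupType) (a b : gT) (r : nat).
Hypotheses (r_gt0 : 0 < r) (ab : a ^ b = a ^+ r).

Lemma conj_cycle_expg c i : c \in <[a]> -> c ^ (b ^+ i) = c ^+ (r ^ i).
Proof.
case/cycleP=> j ->; elim: i => [|i IHi]; first by rewrite conjg1.
by rewrite expgSr conjgM IHi !conjXg ab expnS -!expgM mulnCA.
Qed.

(** The dictionary between centralisers and arithmetic: b ^+ i fixes c exactly
    when c ^+ (r ^ i) = c. *)
Lemma cent_cycle_expg c i :
  c \in <[a]> -> (c \in 'C[b ^+ i]) = (#[c] %| r ^ i - 1).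
Proof.
move=> ac.
rewrite -eqn_mod_dvd ?expn_gt0 ?r_gt0 // -eq_expg_mod_order expg1.
by rewrite -conj_cycle_expg //; apply/cent1P/eqP => [/commgP/conjg_fixP|/conjg_fixP/commgP].
Qed.

(** If the action is semiregular and c <> 1, then #[c] divides r ^ i - 1 only
    for multiples i of #[b]; c = a and i = d give d = #[b], and c of order m1
    gives the condition on proper divisors. Conversely, an h <> 1 in <b>
    generates the same subgroup as b ^+ n1 for a divisor n1 < #[b], so a
    nontrivial c centralised by h has an order m1 dividing r ^ n1 - 1. The
    extreme values that proper divisors leave out are excluded otherwise:
    n1 = 1 by coprimality with r - 1, and m1 = #[a] by the minimality of d. *)
Lemma semiregular_cycleP d :
    1 < #[a] -> coprime #[a] (r - 1) -> r ^ #[b] = 1 %[mod #[a]] ->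
    is_mult_order #[a] r d ->
  semiregular <[a]> <[b]> <->
  d = #[b] /\
  forall m1 n1, proper_divisor #[a] m1 -> proper_divisor #[b] n1 ->
    ~~ (m1 %| r ^ n1 - 1).
Proof.
move=> a_gt1 co_ar1 rb1 [d_gt0 rd1 min_d].
have dvd_exp i : (#[a] %| r ^ i - 1) = (r ^ i == 1 %[mod #[a]]).
  by rewrite -eqn_mod_dvd ?expn_gt0 ?r_gt0.
have le_db : d <= #[b] by apply: min_d; rewrite ?order_gt0.
split=> [reg | [def_d ndvd] h /setD1P[nth bh]].
  have ncent c i : c \in <[a]> -> c != 1 -> #[c] %| r ^ i - 1 -> #[b] %| i.
    move=> ac ntc; rewrite -cent_cycle_expg // => cbi; rewrite order_dvdn.
    apply: contraNT ntc => ntbi; rewrite -in_set1 -[[set 1]](reg (b ^+ i)).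
      by rewrite inE ac.
    by rewrite !inE ntbi mem_cycle.
  split=> [|m1 n1 /and3P[m1a m1n1 _] /and3P[n1b n1n1 n1nb]].
    apply/eqP; rewrite eqn_leq le_db dvdn_leq // (ncent a) ?cycle_id //.
      by rewrite -order_gt1.
    by rewrite dvd_exp; apply/eqP.
  have o_c : #[a ^+ (#[a] %/ m1)] = m1 by rewrite orderXdiv ?dvdn_div // divnA // mulKn.
  apply: contra n1nb => m1r; rewrite eqn_dvd n1b.
  by rewrite (ncent (a ^+ (#[a] %/ m1))) ?mem_cycle -?order_eq1 ?o_c.
apply/trivgP/subsetP=> c /setIP[ac hc]; rewrite inE; apply: contraR nth => ntc.
set n1 := #[b] %/ #[h].
have n1b : n1 %| #[b] by rewrite dvdn_div ?order_dvdG.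
have defh : <[h]> = <[b ^+ n1]>.
  apply/eqP; rewrite (eq_subG_cyclic (cycle_cyclic b)) ?cycle_subG ?mem_cycle //.
  by rewrite [eqbRHS]orderXdiv // divnA ?order_dvdG // mulKn.
have cbn1 : #[c] %| r ^ n1 - 1.
  by rewrite -cent_cycle_expg // -cent_cycle -defh cent_cycle.
have ca : #[c] %| #[a] := order_dvdG ac.
have nc1 : #[c] != 1%N by rewrite order_eq1.
have [n1b1 | n1nb] := eqVneq n1 #[b].
  have : (#[h] * n1 == 1 * n1)%N by rewrite mulnC divnK ?order_dvdG // mul1n n1b1.
  by rewrite eqn_pmul2r ?order_eq1 // n1b1.
have n1_lt : n1 < #[b] by rewrite ltn_neqAle n1nb dvdn_leq.
have [n1_1 | n1n1] := eqVneq n1 1%N.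
  case/negP: nc1; rewrite -dvdn1 -(eqP co_ar1) dvdn_gcd ca.
  by rewrite n1_1 expn1 in cbn1.
have [ca1 | nca] := eqVneq #[c] #[a].
  rewrite ca1 dvd_exp in cbn1; move: n1_lt; rewrite ltnNge -def_d min_d //.
    exact: dvdn_gt0 n1b.
  exact/eqP.
apply: contraLR cbn1 => _; apply: ndvd; rewrite /proper_divisor ?ca ?nc1 ?nca ?n1b ?n1n1 //.
Qed.

End Metacyclic.

End GroupTheory.

Theorem corollary1p3 (m n r d : nat) (gT : finGroupType) (G : {group gT})
    (m_gt0 : 0 < m) (n_gt0 : 0 < n) (r_gt0 : 0 < r)
    (co_mn : coprime m n) (co_mr1 : coprime m (r - 1))
    (rn1 : r ^ n = 1 %[mod m])
    (ZM_G : is_ZM m n r G)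
    (ord_d : is_mult_order m r d) :
  psi_cyclic m + m * (psi_cyclic n - 1) <= psi G /\
  (1 < m ->
     psi G < psi_cyclic m + m ^ 2 * (psi_cyclic n - 1) /\
     (psi_cyclic m + m * (psi_cyclic n - 1) = psi G <->
        d = n /\
        forall m1 n1 : nat, proper_divisor m m1 -> proper_divisor n n1 ->
          ~~ (m1 %| r ^ n1 - 1))).
Proof.
have [a [b [sdG oa ob ab]]] := ZM_sdprod m_gt0 n_gt0 co_mn co_mr1 rn1 ZM_G.
subst m n.
have [le_psi eq_psi] := psi_sdprod_leqif sdG co_mn.
rewrite !psi_cycle in le_psi eq_psi.
split=> // a_gt1; have b_gt1 := ZM_index_gt1 a_gt1 n_gt0 co_mr1 rn1.
split.
  by have := psi_sdprod_lt sdG; rewrite !psi_cycle; apply;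
     rewrite cycle_eq1 -order_gt1.
apply: iff_trans (semiregular_cycleP r_gt0 ab a_gt1 co_mr1 rn1 ord_d).
split=> [/eqP | reg].
  by rewrite eq_psi => /forall_inP reg h Hh; apply/eqP/reg.
by apply/eqP; rewrite eq_psi; apply/forall_inP=> h Hh; apply/eqP/reg.
Qed.
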